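(* Let $p \in (0,1)$ and $s \in [0,1]$, and let $\{S_n\}$ and $\{S'_n\}$ be two independent elephant random walks with the same memory parameter $p$ and first-step parameter $s$. If $0 < p \le 3/4$, then with probability one $S_n = S'_n$ for infinitely many $n$. If $3/4 < p < 1$, then with probability one $S_n = S'_n$ for only finitely many $n$.
   Context: An elephant random walk with memory parameter $p \in (0,1)$ and first-step parameter $s \in [0,1]$ is defined as follows. Let $X_1 = +1$ with probability $s$ and $X_1 = -1$ with probability $1-s$. Let $\{U_n : n \ge 1\}$ be an independent family of random variables with $U_n$ uniformly distributed on $\{1,\dots,n\}$, also independent of $X_1$. For each $n \ge 1$, set $X_{n+1} = X_{U_n}$ with probability $p$ and $X_{n+1} = -X_{U_n}$ with probability $1-p$, where this choice is made independently of everything else. Set $S_0 = 0$ and $S_n = \sum_{i=1}^n X_i$ for $n \ge 1$. ''Meeting'' at time $n$ means $S_n = S'_n$. *)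

(* Defs.v *)
From HB Require Import structures.
From mathcomp Require Import all_boot all_order all_algebra.
From mathcomp Require Import all_classical all_reals all_analysis.
Set Implicit Arguments. Unset Strict Implicit. Unset Printing Implicit Defensive.
Import Order.TTheory GRing.Theory Num.Theory.
Local Open Scope classical_set_scope.
Local Open Scope ring_scope.

(* Primitive randomness of two elephant random walks, indexed by w : bool
   (w = false : walk S, w = true : walk S').  Steps are 0-indexed:
   paper's X_{m+1} is our step m.
   - X1 w : bool          true means X_1 = +1, false means X_1 = -1
   - U w m : 'I_m.+1      0-indexed version of the paper's U_{m+1}
                          (uniform on {1,...,m+1}, shifted down by one)
   - C w m : bool         true means X_{m+2} = X_{U_{m+1}} (prob. p),
                          false means X_{m+2} = - X_{U_{m+1}}. *)

Inductive atom :=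
  | AX of bool & bool
  | AU of bool & nat & nat
  | AC of bool & nat & bool.

Inductive var := VX of bool | VU of bool & nat | VC of bool & nat.

Definition var_code (v : var) : nat * nat * nat :=
  match v with
  | VX w => (0%N, nat_of_bool w, 0%N)
  | VU w m => (1%N, nat_of_bool w, m)
  | VC w m => (2%N, nat_of_bool w, m)
  end.

Definition atom_var (a : atom) : var :=
  match a with AX w _ => VX w | AU w m _ => VU w m | AC w m _ => VC w m end.

Definition atom_event (T : Type) (X1 : bool -> T -> bool)
  (U : bool -> forall m : nat, T -> 'I_m.+1) (C : bool -> nat -> T -> bool)
  (a : atom) : set T :=
  match a with
  | AX w b => [set t | X1 w t = b]
  | AU w m k => [set t | nat_of_ord (U w m t) = k]
  | AC w m b => [set t | C w m t = b]
  end.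

Definition mutually_independent d (T : measurableType d) (R : realType)
  (P : probability T R) (X1 : bool -> T -> bool)
  (U : bool -> forall m : nat, T -> 'I_m.+1) (C : bool -> nat -> T -> bool) :=
  forall s : seq atom, uniq (map (fun a => var_code (atom_var a)) s) ->
    P (foldr (fun a A => atom_event X1 U C a `&` A) setT s) =
    (\prod_(a <- s) P (atom_event X1 U C a))%E.

(* history of steps X_1, ..., X_{m+1} (0-indexed list of length m+1) *)
Fixpoint erw_hist (T : Type) (X1 : T -> bool)
  (U : forall m : nat, T -> 'I_m.+1) (C : nat -> T -> bool)
  (m : nat) (t : T) : seq int :=
  match m with
  | 0%N => [:: if X1 t then (1 : int) else (-1 : int)]
  | m'.+1 =>
      let h := erw_hist X1 U C m' t in
      rcons h ((if C m' t then (1 : int) else (-1 : int)) * nth (0 : int) h (U m' t))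
  end.

Definition erw_pos (T : Type) (X1 : T -> bool)
  (U : forall m : nat, T -> 'I_m.+1) (C : nat -> T -> bool)
  (n : nat) (t : T) : int :=
  \sum_(i < n) nth 0 (erw_hist X1 U C n t) i.

(* Main.v *)
Require Import Defs.
From HB Require Import structures.
From mathcomp Require Import all_boot all_order all_algebra.
From mathcomp Require Import all_classical all_reals all_analysis.
From mathcomp Require Import ring lra zify.
Import Order.TTheory GRing.Theory Num.Theory.
Local Open Scope classical_set_scope.
Local Open Scope ring_scope.
Set Implicit Arguments. Unset Strict Implicit. Unset Printing Implicit Defensive.

(** Let D be the difference of the two walks and alpha = 2p - 1. After n steps
    D moves by 2, -2 or 0 with probabilities a, b, 1 - a - b, where
    a - b = alpha D / (2n) and a, b are bounded away from 0; D is always even,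
    so it cannot change sign without vanishing.

    If alpha <= 1/2, let B_n be the product of the 1 + 1/(2k), k < n, so that
    B_n^2 = O(n), and y = |D| / B_n. As long as the walks do not meet, y is a
    supermartingale and the bounded function y / (1 + y) loses on average at
    least a multiple of 1 / (n (3 + y)^3) at step n. If non-meeting had positive
    probability, the bound on E y would turn these losses into a multiple of the
    harmonic series.

    If alpha > 1/2, then psi_n = n w_n / (A n + D^2), with w_n the product of the
    1 + eps/k, is eventually a supermartingale for A large and eps small. Its
    value at a meeting is w_n / A, which tends to infinity, so by the maximal
    inequality a meeting after time m has probability O(1 / w_m). *)

(** * Drift inequalities *)

(** The second-order expansion at [y] is exact with remainder
    [(z - y) ^+ 2 / ((1 + y) ^+ 2 * (1 + z))], and both [1 + y] and [1 + z] are at most [3 + y]. *)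
Lemma recip_taylor (R : realFieldType) (y z : R) :
  0 <= y -> 0 <= z -> z - y <= 2 ->
  (1 + y)^-1 - (z - y) / (1 + y) ^+ 2 + (z - y) ^+ 2 / (3 + y) ^+ 3
    <= (1 + z)^-1.
Proof.
move=> y0 z0 zy.
have y1 : 0 < 1 + y by lra.
have z1 : 0 < 1 + z by lra.
have y3 : 0 < 3 + y by lra.
have -> : (1 + z)^-1 = (1 + y)^-1 - (z - y) / (1 + y) ^+ 2
    + (z - y) ^+ 2 / ((1 + y) ^+ 2 * (1 + z)).
  by field; rewrite !lt0r_neq0.
rewrite lerD2l ler_wpM2l ?sqr_ge0 // lef_pV2 ?posrE ?mulr_gt0 ?exprn_gt0 //.
rewrite ?posrE [leRHS]exprSr; apply: ler_pM; rewrite ?sqr_ge0 //; nra.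
Qed.

(** The mean of the new numerator is [x * (1 + al / N)]; for [al] at most 1/2 the factor [B' / B]
    absorbs this growth. *)
Lemma mean_step (R : realFieldType) (al a b N x B B' : R) :
  al <= 2^-1 -> 0 < N -> 0 <= x -> 0 < B -> B' = B * (1 + (2 * N)^-1) ->
  a - b = al * x / (2 * N) ->
  a * ((x + 2) / B') + b * ((x - 2) / B') + (1 - a - b) * (x / B') <= x / B.
Proof.
move=> hal N0 x0 B0 hB' hab.
have N1 : 0 < (2 * N)^-1 by rewrite invr_gt0; lra.
have B'0 : 0 < B' by rewrite hB' mulr_gt0 //; lra.
have -> : a * ((x + 2) / B') + b * ((x - 2) / B') + (1 - a - b) * (x / B')
    = (x + 2 * (a - b)) / B' by field; rewrite lt0r_neq0.
rewrite hab ler_pdivrMr // hB' [X in _ <= X](_ : _ = x + x / (2 * N)).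
  have h0 : 0 <= x / (2 * N) by apply: mulr_ge0; [lra|exact: ltW].
  by rewrite lerD2l -mulrA; nra.
by field; rewrite !lt0r_neq0.
Qed.

(** This is y / (1 + y), in the form suited to [recip_taylor]. It is bounded for y >= 0 and vanishes
    at 0, so a meeting contributes nothing. *)
Definition phi (R : realFieldType) (y : R) : R := 1 - (1 + y)^-1.


(** Expand [phi] at [x / B]: the first-order term is nonpositive by [mean_step], and among the
    second-order terms the downward move alone gives the stated loss. *)
Lemma recurrent_step (R : realFieldType) (al a b c N x B B' : R) :
  al <= 2^-1 -> 0 < N -> 2 <= x -> 1 <= B -> B' = B * (1 + (2 * N)^-1) ->
  B' ^+ 2 <= 2 * N + 1 ->
  0 <= c -> c <= a -> c <= b -> a + b <= 1 -> a - b = al * x / (2 * N) ->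
  a * phi ((x + 2) / B') + b * phi ((x - 2) / B') + (1 - a - b) * phi (x / B')
   <= phi (x / B) - 4 * c / (2 * N + 1) / (3 + x / B) ^+ 3.
Proof.
move=> hal N0 x2 B1 hB' hB2 c0 ca cb ab1 hab.
have B0 : 0 < B by lra.
have N1 : 0 < (2 * N)^-1 by rewrite invr_gt0; lra.
have BB' : B <= B' by rewrite hB'; nra.
have B'0 : 0 < B' by lra.
set y := x / B.
have y0 : 0 <= y by rewrite divr_ge0 //; lra.
have dle u : u <= 2 -> (x + u) / B' - y <= 2.
  move=> u2.
  have : (x + u) / B' <= (x + 2) / B' by rewrite ler_pM2r ?invr_gt0 //; lra.
  have : x / B' <= y by rewrite ler_pM2l ?lef_pV2 ?posrE //; lra.
  have : 2 / B' <= 2 by rewrite ler_pdivrMr //; lra.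
  by rewrite !mulrDl; lra.
have T u : -2 <= u -> u <= 2 -> 
   phi ((x + u) / B') <= phi y + ((x + u) / B' - y) / (1 + y) ^+ 2
      - ((x + u) / B' - y) ^+ 2 / (3 + y) ^+ 3.
  move=> u1 u2.
  have z0 : 0 <= (x + u) / B' by rewrite divr_ge0 //; lra.
  by have := recip_taylor y0 z0 (dle u u2); rewrite /phi; lra.
have a0 : 0 <= a by lra.
have b0 : 0 <= b by lra.
have c1 : 0 <= 1 - a - b by lra.
have Tp := ler_wpM2l a0 (T 2 ltac:(lra) ltac:(lra)).
have Tm := ler_wpM2l b0 (T (-2) ltac:(lra) ltac:(lra)).
have Tz := ler_wpM2l c1 (T 0 ltac:(lra) ltac:(lra)).
rewrite addr0 in Tz.
set dp := (x + 2) / B' - y in Tp.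
set dm := (x - 2) / B' - y in Tm.
set d0 := x / B' - y in Tz.
have q1 : 0 <= ((1 + y) ^+ 2)^-1 by rewrite invr_ge0 sqr_ge0.
have q3 : 0 <= ((3 + y) ^+ 3)^-1 by rewrite invr_ge0 exprn_ge0 //; lra.
set Q1 := (_ ^+ 2)^-1 in Tp Tm Tz q1.
set Q3 := (_ ^+ 3)^-1 in Tp Tm Tz q3.
have mean : a * dp + b * dm + (1 - a - b) * d0 <= 0.
  have := mean_step hal N0 (_ : 0 <= x) B0 hB' hab.
  by rewrite /dp /dm /d0 -/y => /(_ ltac:(lra)); lra.
(* Rescaling alone gives [d0 <= 0], so the downward move shifts [y] by at least [2 / B'], whose
   square is at least [4 / (2 * N + 1)]. *)
have var : 4 * c / (2 * N + 1) <= b * dm ^+ 2.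
  have d00 : d0 <= 0.
    by rewrite subr_le0 ler_pM2l ?lef_pV2 ?posrE //; lra.
  have dmE : dm = d0 - 2 / B' by rewrite /dm /d0; field; rewrite lt0r_neq0.
  have h2 : 0 < 2 / B' by rewrite divr_gt0.
  have : (2 / B') ^+ 2 <= dm ^+ 2 by rewrite dmE; nra.
  have : 4 / (2 * N + 1) <= (2 / B') ^+ 2.
    rewrite expr_div_n (_ : 2 ^+ 2 = 4); last by ring.
    by rewrite ler_pM2l ?lef_pV2 ?posrE ?exprn_gt0 //; lra.
  have : 0 < 4 / (2 * N + 1) by rewrite divr_gt0 //; lra.
  rewrite -mulrA mulrCA.
  set u := 4 / _; set v := dm ^+ 2; set w := (2 / B') ^+ 2.
  move=> *; apply: ler_pM => //; lra.
have nn1 : 0 <= a * dp ^+ 2 by rewrite mulr_ge0 ?sqr_ge0.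
have nn2 : 0 <= (1 - a - b) * d0 ^+ 2 by rewrite mulr_ge0 ?sqr_ge0.
have m1 := ler_wpM2r q1 mean.
have v1 := ler_wpM2r q3 var.
have n1 := mulr_ge0 nn1 q3.
have n2 := mulr_ge0 nn2 q3.
rewrite mul0r in m1.
move: Tp Tm Tz m1 v1 n1 n2.
rewrite -/y.
move: (phi y) (phi (_ / B')) (phi (_ / B')) (phi (_ / B')) => P0 Fp Fm Fz.
rewrite -/Q3.
clearbody dp dm d0 Q1 Q3; move: (4 * c / _) => W; lra.
Qed.

(* [transient_step] with its denominators cleared: [y] is [D ^+ 2], [u] is [a + b]. *)
Lemma transient_poly (R : realFieldType) (al A eps c N u y : R) :
  0 <= eps -> 0 < A -> 0 < N -> 0 < c -> 26 <= A * (2 * al - 1) ->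
  4 * eps <= 2 * al - 1 ->
  eps * A <= 4 * c -> (2 * A + 9) * (1 + eps) <= N -> (2 * A + 9) * eps <= 4 * c * N ->
  2 * c <= u -> u <= 1 -> 0 <= y ->
  (A * N + y + (2 * A + 9)) * (eps * A * N + (1 + eps) * y) <=
  u * N * (4 * (A * (N + 1) + y) + 16 - 16 * y) + 2 * al * y * (A * (N + 1) + y).
Proof.
move=> e0 A0 N0 c0 hA hep h1 h2 h3 cu u1 y0.
have AN : 0 <= A * N by nra.
have Ny : 0 <= N * y by nra.
(* Monomials in [N] and [y] are compared one by one. The term [4 * u * A * N ^+ 2] pays for [k1] and
   [k3]. In [N * y] the cost is 12 from [u <= 1] and 1 from [k2]; half of [A * (2 * al - 1)] covers
   these 13, hence the 26, and the other half covers [2 * eps * A]. *)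
have k1 : eps * A * (A * N * N) <= 4 * c * (A * N * N).
  by apply: ler_wpM2r => //; nra.
have k3 : (2 * A + 9) * eps * (A * N) <= 4 * c * N * (A * N).
  by apply: ler_wpM2r.
have k4 : 2 * c * (4 * N * (A * N)) <= u * (4 * N * (A * N)).
  by apply: ler_wpM2r => //; nra.
have k2 : (2 * A + 9) * (1 + eps) * y <= N * y by apply: ler_wpM2r.
have k5 : u * (N * y) <= 1 * (N * y) by apply: ler_wpM2r.
have k6 : 26 * (N * y) <= A * (2 * al - 1) * (N * y) by apply: ler_wpM2r.
have k7 : 4 * eps * (A * (N * y)) <= (2 * al - 1) * (A * (N * y)).
  by apply: ler_wpM2r => //; nra.
have k8 : (1 + eps) * (y * y) <= 2 * al * (y * y).
  by apply: ler_wpM2r; [nra|lra].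
have k9 : 0 <= al * y * A by rewrite !mulr_ge0 //; lra.
have k10 : 0 <= u * N * (4 * A + 16) by rewrite !mulr_ge0 //; lra.
lra.
Qed.

(** The denominators for [D + 2] and [D - 2] multiply to [Q], a polynomial in [m] and [D ^+ 2]. The
    mean of the reciprocals is then [m^-1] minus an explicit gain [NX / (N * m * Q)], which
    [transient_poly] shows to be large enough. *)
Lemma transient_step (R : realFieldType) (al A eps a b c N D : R) :
  0 <= eps -> 0 < A -> 0 < N -> 0 < c -> 26 <= A * (2 * al - 1) ->
  4 * eps <= 2 * al - 1 ->
  eps * A <= 4 * c -> (2 * A + 9) * (1 + eps) <= N -> (2 * A + 9) * eps <= 4 * c * N ->
  (A + 4) ^+ 2 <= A * N ->
  c <= a -> c <= b -> a + b <= 1 -> a - b = al * D / (2 * N) ->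
  (1 + (1 + eps) / N) * (a / (A * (N + 1) + (D + 2) ^+ 2)
      + b / (A * (N + 1) + (D - 2) ^+ 2)
      + (1 - a - b) / (A * (N + 1) + D ^+ 2)) <= (A * N + D ^+ 2)^-1.
Proof.
move=> e0 A0 N0 c0 hA hep h1 h2 h3 h4 ca cb ab1 hab.
have y0 : 0 <= D ^+ 2 by exact: sqr_ge0.
have := transient_poly e0 A0 N0 c0 hA hep h1 h2 h3 (_ : 2 * c <= a + b) ab1 y0.
move=> /(_ ltac:(lra)).
set g := A * N + D ^+ 2; set K := 2 * A + 9; set L := _ + (1 + eps) * _.
set m := A * (N + 1) + D ^+ 2.
have mE : m = g + A by rewrite /m /g; ring.
have AN : 0 < A * N by rewrite mulr_gt0.
have g0 : 0 < g by rewrite /g; lra.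
have m0 : 0 < m by rewrite mE; lra.
have dp : 0 < A * (N + 1) + (D + 2) ^+ 2.
  by have := sqr_ge0 (D + 2); rewrite mulrDr; lra.
have dm : 0 < A * (N + 1) + (D - 2) ^+ 2.
  by have := sqr_ge0 (D - 2); rewrite mulrDr; lra.
set Q := (m + 4) ^+ 2 - 16 * D ^+ 2.
have QE : Q = (A * (N + 1) + (D + 2) ^+ 2) * (A * (N + 1) + (D - 2) ^+ 2).
  by rewrite /Q /m; ring.
have Q0 : 0 < Q by rewrite QE mulr_gt0.
(* [K] is 2 (A + 4) + 1: the first part is the cross term of [(g + A + 4) ^+ 2], and the extra 1
   absorbs [(A + 4) ^+ 2 <= g]. *)
have Qg : Q <= g * (g + K).
  have : (A + 4) ^+ 2 <= g by rewrite /g; lra.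
  rewrite /Q mE /K; nra.
have L0 : 0 <= L.
  apply: addr_ge0; first by apply: mulr_ge0; [apply: mulr_ge0|]; lra.
  by apply: mulr_ge0 => //; lra.
move=> key.
pose NX := (a + b) * N * (4 * m + 16 - 16 * D ^+ 2) + 2 * al * D ^+ 2 * m.
have sumE : a / (A * (N + 1) + (D + 2) ^+ 2)
      + b / (A * (N + 1) + (D - 2) ^+ 2)
      + (1 - a - b) / m = m^-1 - NX / (N * m * Q).
  have -> : a / (A * (N + 1) + (D + 2) ^+ 2) + b / (A * (N + 1) + (D - 2) ^+ 2)
     = ((a + b) * (m + 4) - 4 * D * (a - b)) / Q.
    by rewrite QE /m; field; rewrite !lt0r_neq0.
  rewrite hab /NX; have QQ : Q = (m + 4) ^+ 2 - 16 * D ^+ 2 by [].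
  move: Q0 m0; clearbody m Q => Q0 m0.
  have QD : 16 * D ^+ 2 = (m + 4) ^+ 2 - Q.
    by rewrite QQ; ring.
  rewrite QD.
  field; rewrite !lt0r_neq0 //.
rewrite sumE.
have NXg : L * Q <= NX * g.
  have k1 : L * Q <= L * (g * (g + K)) by rewrite ler_wpM2l.
  have k2 : (g + K) * L * g <= NX * g by rewrite ler_wpM2r // ltW.
  by apply: le_trans k1 _; apply: le_trans k2; rewrite le_eqVlt; apply/orP; left; apply/eqP; ring.
have NX0 : 0 <= NX by apply: le_trans key; apply: mulr_ge0 => //; rewrite /K; lra.
have -> : (1 + (1 + eps) / N) * (m^-1 - NX / (N * m * Q)) =
   g^-1 - (N * (NX * g - L * Q) + (1 + eps) * NX * g) / (N * N * m * Q * g).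
  (* Thus [L / (N * m * g)] is the excess of [(1 + (1 + eps) / N) / m] over [g^-1], which the gain
     [NX] has to offset. *)
  have LE : L = (N + (1 + eps)) * g - N * m by rewrite /L mE /g; ring.
  rewrite LE; clearbody m Q g NX.
  by field; rewrite !lt0r_neq0.
rewrite lerBlDr lerDl //; apply: divr_ge0.
  apply: addr_ge0; first by apply: mulr_ge0; lra.
  by apply: mulr_ge0; [apply: mulr_ge0|]; lra.
by rewrite !mulr_ge0 // ltW.
Qed.

(** * The joint law of the two histories *)

Definition sgn (b : bool) : int := if b then 1 else -1.

Definition bern (R : pzRingType) (q : R) (b : bool) : R := if b then q else 1 - q.

Definition extend n (h : seq int) (kc : 'I_n.+1 * bool) : seq int :=
  rcons h (sgn kc.2 * nth 0 h kc.1).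

Definition step1 (R : realType) (p : R) n (G : seq int -> R) (h : seq int) : R :=
  \sum_(kc : 'I_n.+1 * bool) n.+1%:R^-1 * bern p kc.2 * G (extend h kc).

Definition step2 (R : realType) (p : R) n (F : seq int -> seq int -> R) h h' : R :=
  step1 p n (fun g => step1 p n (F g) h') h.

(* Expectation of a function of the first n+1 steps of the two walks, integrating
   out the last step first. *)
Fixpoint esp (R : realType) (p s : R) n (F : seq int -> seq int -> R) : R :=
  match n with
  | 0%N => \sum_(b : bool) bern s b * \sum_(b' : bool) bern s b' * F [:: sgn b] [:: sgn b']
  | n'.+1 => esp p s n' (step2 p n' F)
  end.

(* The randomness in [a] is not used by the first n+1 steps. *)
Definition fresh n (a : atom) : bool :=
  match a with AX _ _ => false | AU _ m _ => (n <= m)%N | Defs.AC _ m _ => (n <= m)%N end.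

Definition codes (l : seq atom) := map (fun a => var_code (atom_var a)) l.

Lemma notin_codes n c (l : seq atom) : all (fresh n) l ->
  (forall a, fresh n a -> var_code (atom_var a) != c) -> c \notin codes l.
Proof.
move=> fl fc; elim: l fl => //= a l IH /andP[fa fl].
by rewrite inE negb_or IH // eq_sym fc.
Qed.

Section Esp.
Variables (R : realType) (p s : R).

Lemma step2E n F h h' : step2 p n F h h' =
  \sum_(i : ('I_n.+1 * bool) * ('I_n.+1 * bool))
    (n.+1%:R^-1 * bern p i.1.2 * (n.+1%:R^-1 * bern p i.2.2)) *
      F (extend h i.1) (extend h' i.2).
Proof.
rewrite -(pair_bigA _ (fun i j : 'I_n.+1 * bool =>
  (n.+1%:R^-1 * bern p i.2 * (n.+1%:R^-1 * bern p j.2)) *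
    F (extend h i) (extend h' j))) /=.
by apply: eq_bigr => i _; rewrite mulr_sumr; apply: eq_bigr => j _; rewrite !mulrA.
Qed.

Lemma step1_lin n c G G' h :
  step1 p n (fun g => c * G g + G' g) h = c * step1 p n G h + step1 p n G' h.
Proof.
by rewrite /step1 mulr_sumr -big_split /=; apply: eq_bigr => i _; ring.
Qed.

Lemma step2_lin n c F G h h' :
  step2 p n (fun g g' => c * F g g' + G g g') h h' =
  c * step2 p n F h h' + step2 p n G h h'.
Proof.
rewrite /step2 -step1_lin; congr (step1 p n _ h).
by apply/funext => g; rewrite step1_lin.
Qed.

Lemma esp_lin n c F G :
  esp p s n (fun g g' => c * F g g' + G g g') = c * esp p s n F + esp p s n G.
Proof.
elim: n F G => [|n IH] F G /=; last first.
  by rewrite -IH; congr (esp p s n _); apply/funext => h; apply/funext => h';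
     rewrite step2_lin.
by rewrite !big_bool /=; ring.
Qed.

Lemma esp0 n : esp p s n (fun _ _ => 0) = 0.
Proof.
(* With coefficient -1, linearity reads e = - e + e. *)
have := esp_lin n (-1) (fun _ _ => 0) (fun _ _ => 0).
rewrite (_ : (fun _ _ => _) = (fun _ _ => 0 : R)); last first.
  by apply/funext => g; apply/funext => g'; ring.
by move=> ->; ring.
Qed.

Lemma esp_sum n (I : finType) (c : I -> R) (F : I -> seq int -> seq int -> R) :
  esp p s n (fun g g' => \sum_i c i * F i g g') = \sum_i c i * esp p s n (F i).
Proof.
elim: (index_enum I) => [|i r IH].
  rewrite big_nil -[RHS](esp0 n); congr (esp p s n _).
  by apply/funext => g; apply/funext => g'; rewrite big_nil.
rewrite big_cons -IH -esp_lin; congr (esp p s n _).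
by apply/funext => g; apply/funext => g'; rewrite big_cons.
Qed.

End Esp.

(** The measurability of [A] is a conclusion: [A] is the finite disjoint union of its traces on the
    fibers of [f]. *)
Lemma measure_fibers d (T : measurableType d) (R : realType) (P : probability T R)
    (I : finType) (f : T -> I) (A : set T) :
  (forall i, measurable (A `&` [set t | f t = i])) ->
  measurable A /\ P A = (\sum_(i : I) P (A `&` [set t | f t = i]))%E.
Proof.
move=> mA.
have AE : A = \bigcup_(i in [set: I]) (A `&` [set t | f t = i]).
  apply/seteqP; split => [t At|t [i _ []]//].
  by exists (f t).
have fI : finite_set [set: I] by exact: finite_finset.
split; first by rewrite AE; apply: fin_bigcup_measurable.
rewrite {1}AE measure_fin_bigcup //; last first.
  by move=> i j _ _ [t [[_ <-] [_ <-]]].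
rewrite (_ : [set: I] = [set` index_enum I]); last first.
  by apply/seteqP; split => i //= _; rewrite mem_index_enum.
by rewrite -fsbig_seq ?index_enum_uniq.
Qed.

Section Transfer.
Context (R : realType) (d : measure_display) (T : measurableType d)
  (P : probability T R) (p s : R)
  (X1 : bool -> T -> bool) (U : bool -> forall m : nat, T -> 'I_m.+1)
  (C : bool -> nat -> T -> bool).
Hypotheses (mE : forall a : atom, measurable (atom_event X1 U C a))
  (PX : forall w b, P [set t | X1 w t = b] = (bern s b)%:E)
  (PU : forall w m (k : 'I_m.+1), P [set t | U w m t = k] = (m.+1%:R)^-1%:E)
  (PC : forall w m b, P [set t | C w m t = b] = (bern p b)%:E)
  (ind : mutually_independent P X1 U C).

Local Notation ev := (atom_event X1 U C).
Local Notation hist w := (erw_hist (X1 w) (U w) (C w)).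
(** The intersection is nested exactly as in [mutually_independent], so that [ind] applies after
    unfolding. *)
Definition cyl (l : seq atom) : set T := foldr (fun a A => ev a `&` A) setT l.

Lemma measurable_cyl l : measurable (cyl l).
Proof. by elim: l => [|a l IH] /=; [exact: measurableT | exact: measurableI]. Qed.

Definition pr (l : seq atom) : R := \prod_(a <- l) fine (P (ev a)).

Lemma prob_cyl l : uniq (codes l) -> P (cyl l) = (pr l)%:E.
Proof.
move=> ul; rewrite /cyl ind // /pr -prodEFin; apply: eq_bigr => a _.
by rewrite fineK // fin_num_measure.
Qed.

Lemma pr_AX w b : fine (P (ev (AX w b))) = bern s b.
Proof. by rewrite /= PX. Qed.

Lemma pr_AU w m (k : 'I_m.+1) : fine (P (ev (AU w m k))) = m.+1%:R^-1.
Proof.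
rewrite (_ : ev _ = [set t | U w m t = k]) ?PU //.
by apply/seteqP; split => t /= => [/val_inj|->].
Qed.

Lemma pr_AC w m b : fine (P (ev (Defs.AC w m b))) = bern p b.
Proof. by rewrite /= PC. Qed.

(* The cylinder [cyl l] carries the independence of the future through the induction. *)
Lemma prob_hist n (b : seq int -> seq int -> bool) (l : seq atom) :
  uniq (codes l) -> all (fresh n) l ->
  measurable ([set t | b (hist false n t) (hist true n t)] `&` cyl l) /\
  P ([set t | b (hist false n t) (hist true n t)] `&` cyl l) =
    (esp p s n (fun h h' => (b h h')%:R) * pr l)%:E.
Proof.
elim: n b l => [|n IH] b l ul fl; set A := _ `&` _.
- pose f t := (X1 false t, X1 true t).
  have fib i : A `&` [set t | f t = i] =
     if b [:: sgn i.1] [:: sgn i.2] then cyl [:: AX false i.1, AX true i.2 & l]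
     else set0.
    case: i => i1 i2; apply/seteqP; split => t.
      by rewrite /A /f /= => -[[bt ct] [e1 e2]]; rewrite /sgn -e1 -e2 bt.
    case: ifP => //=; rewrite /A /f /sgn /= => bt [e1 [e2 ct]].
    by rewrite e1 e2.
  have ul' i1 i2 : uniq (codes [:: AX false i1, AX true i2 & l]).
    have nX w : var_code (VX w) \notin codes l.
      by apply: notin_codes fl _; case.
    by have /= n0 := nX false; have /= n1 := nX true; rewrite inE negb_or ul n0 n1.
  have [|mA ->] := @measure_fibers _ _ _ P _ f A.
    by move=> i; rewrite fib; case: ifP => _; [exact: measurable_cyl|].
  split => //.
  under eq_bigr => i _.
    rewrite fib (_ : P _ = (bern s i.1 * (bern s i.2 *
      ((b [:: sgn i.1] [:: sgn i.2])%:R * pr l)))%:E); last first.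
      case: ifP => _; last by rewrite measure0 mul0r !mulr0.
      by rewrite prob_cyl // /pr !big_cons !pr_AX mul1r.
    over.
  rewrite sumEFin -(pair_bigA _ (fun i j => bern s i * (bern s j *
     ((b [:: sgn i] [:: sgn j])%:R * pr l)))) /=; congr EFin.
  rewrite mulr_suml; apply: eq_bigr => i _.
  rewrite -mulrA mulr_suml mulr_sumr; apply: eq_bigr => j _.
  by rewrite !mulrA.
- pose f t := ((U false n t, C false n t), (U true n t, C true n t)).
  pose l' (i : ('I_n.+1 * bool) * ('I_n.+1 * bool)) :=
    [:: AU false n i.1.1, Defs.AC false n i.1.2, AU true n i.2.1, Defs.AC true n i.2.2 & l].
  pose b' (i : ('I_n.+1 * bool) * ('I_n.+1 * bool)) h h' :=
     b (extend h i.1) (extend h' i.2).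
  have fib i : A `&` [set t | f t = i] =
     [set t | b' i (hist false n t) (hist true n t)] `&` cyl (l' i).
    case: i => -[i1 i2] [i3 i4]; apply/seteqP; split => t.
      by rewrite /A /f /b' /extend /sgn /= => -[[bt ct] [<- <- <- <-]].
    rewrite /A /f /b' /extend /sgn /=.
    by move=> -[bt [/val_inj e1 [e2 [/val_inj e3 [e4 ct]]]]]; rewrite e1 e2 e3 e4.
  have ul' i : uniq (codes (l' i)).
    have nU w : var_code (VU w n) \notin codes l.
      by apply: notin_codes fl _ => -[]//= w' m k le; apply/eqP => -[] _ ?; lia.
    have nC w : var_code (VC w n) \notin codes l.
      by apply: notin_codes fl _ => -[]//= w' m k le; apply/eqP => -[] _ ?; lia.
    have /= u0 := nU false; have /= u1 := nU true.
    have /= c0 := nC false; have /= c1 := nC true.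
    by rewrite !inE !negb_or ul u0 u1 c0 c1.
  have fl' i : all (fresh n) (l' i).
    rewrite /= !leqnn /=; apply: sub_all fl => -[]//= w m k; exact: ltnW.
  have [|mA ->] := @measure_fibers _ _ _ P _ f A.
    by move=> i; rewrite fib; have [] := IH (b' i) (l' i) (ul' i) (fl' i).
  split => //.
  under eq_bigr => i _.
    rewrite fib; have [_ ->] := IH (b' i) (l' i) (ul' i) (fl' i).
    over.
  rewrite sumEFin; congr EFin.
  rewrite /= [X in esp p s n X](_ : _ = fun h h' => \sum_i
    (n.+1%:R^-1 * bern p i.1.2 * (n.+1%:R^-1 * bern p i.2.2)) * (b' i h h')%:R); last first.
    by apply/funext => h; apply/funext => h'; rewrite step2E.
  rewrite (esp_sum p s n _ (fun i h h' => (b' i h h')%:R)) mulr_suml; apply: eq_bigr => i _.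
  by rewrite /pr !big_cons !pr_AU !pr_AC /b'; ring.
Qed.

Lemma prob_event n (b : seq int -> seq int -> bool) :
  measurable [set t | b (hist false n t) (hist true n t)] /\
  P [set t | b (hist false n t) (hist true n t)] =
    (esp p s n (fun h h' => (b h h')%:R))%:E.
Proof.
by have := @prob_hist n b [::] isT isT; rewrite /pr big_nil mulr1 /cyl /= setIT.
Qed.
End Transfer.

(** * The difference of the two walks *)

Definition pm1 (x : int) : bool := (x == 1) || (x == -1).

Definition valid n (h : seq int) : bool := (size h == n.+1) && all pm1 h.

Definition tot (h : seq int) : int := \sum_(x <- h) x.

(* No meeting after k+1 steps, for m <= k <= n. *)
Definition nomeet m n (h h' : seq int) : bool :=
  all (fun k => tot (take k.+1 h) != tot (take k.+1 h')) (iota m (n.+1 - m)).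

Lemma pm1_sgnM b x : pm1 x -> pm1 (sgn b * x).
Proof. by case: b => /orP[] /eqP ->. Qed.

Lemma valid_nth n h (k : 'I_n.+1) : valid n h -> pm1 (nth 0 h k).
Proof. by case/andP => /eqP sh /all_nthP; apply; rewrite sh. Qed.

Lemma valid_extend n h kc : valid n h -> valid n.+1 (@extend n h kc).
Proof.
move=> vh; have := vh => /andP[/eqP sh ah].
by rewrite /valid /extend size_rcons sh eqxx all_rcons ah pm1_sgnM ?(valid_nth _ vh).
Qed.

Lemma tot_rcons h x : tot (rcons h x) = tot h + x.
Proof. by rewrite /tot -cats1 big_cat big_seq1. Qed.

Lemma tot_parity h : all pm1 h -> exists z : int, tot h = (size h)%:Z + 2 * z.
Proof.
elim/last_ind: h => [_|h x IH]; first by exists 0; rewrite /tot big_nil.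
rewrite all_rcons tot_rcons size_rcons => /andP[px /IH[z ->]].
by case/orP: px => /eqP ->; [exists z|exists (z - 1)]; lia.
Qed.

Lemma tot_bound h : all pm1 h -> `|tot h| <= (size h)%:Z.
Proof.
elim/last_ind: h => [_|h x IH]; first by rewrite /tot big_nil.
rewrite all_rcons tot_rcons size_rcons => /andP[px /IH].
by case/orP: px => /eqP ->; lia.
Qed.

Lemma nomeetS m n h h' x x' : (m <= n.+1)%N -> valid n h -> valid n h' ->
  nomeet m n.+1 (rcons h x) (rcons h' x') =
  nomeet m n h h' && (tot (rcons h x) != tot (rcons h' x')).
Proof.
move=> mn /andP[/eqP sh _] /andP[/eqP sh' _].
rewrite /nomeet subSn // -addn1 iotaD all_cat subnKC //= andbT; congr (_ && _).
  apply: eq_in_all => k; rewrite mem_iota subnKC // => /andP[_ kn].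
  by rewrite -!cats1 !takel_cat ?sh ?sh'.
by rewrite !take_oversize // size_rcons ?sh ?sh'.
Qed.

Lemma nomeetnn n h h' : valid n h -> valid n h' ->
  nomeet n n h h' = (tot h != tot h').
Proof.
move=> /andP[/eqP sh _] /andP[/eqP sh' _].
by rewrite /nomeet subSnn /= andbT !take_oversize ?sh ?sh'.
Qed.

Section Drift.
Variables (R : realType) (p s : R).
Definition dif (h h' : seq int) : R := (tot h - tot h')%:~R.

(** Both totals have the parity of [n.+1], so their difference is even. *)
Lemma dif_dichotomy n h h' : valid n h -> valid n h' ->
  dif h h' = 0 \/ 2 <= `|dif h h'|.
Proof.
move=> /andP[/eqP sh /tot_parity[z tz]] /andP[/eqP sh' /tot_parity[z' tz']].
rewrite /dif tz tz' sh sh'.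
have -> : n.+1%:Z + 2 * z - (n.+1%:Z + 2 * z') = 2 * (z - z') by ring.
have [->|nz] := eqVneq z z'; [by left; rewrite subrr mulr0|right].
by rewrite -intr_norm (_ : 2 = 2%:~R) // ler_int; lia.
Qed.

Lemma dif_eq0 h h' : (dif h h' == 0) = (tot h == tot h').
Proof. by rewrite /dif intr_eq0 subr_eq0. Qed.

Definition alpha : R := 2 * p - 1.
(** Each walk steps up or down with probability at least (1 - |alpha|) / 2; opposite steps of the
    two independent walks have at least the square of this. *)
Definition minprob : R := (1 - `|alpha|) ^+ 2 / 4.

Hypotheses (p01 : 0 < p < 1) (s01 : 0 <= s <= 1).

Lemma alpha_lt1 : `|alpha| < 1.
Proof. by case/andP: p01 => p0 p1; rewrite ltr_norml /alpha; apply/andP; split; lra. Qed.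

Lemma minprob_gt0 : 0 < minprob.
Proof. by rewrite divr_gt0 // exprn_gt0 // subr_gt0 alpha_lt1. Qed.

Lemma bern_ge0 (q : R) b : 0 <= q <= 1 -> 0 <= bern q b.
Proof. by case: b => /= /andP[q0 q1] //; rewrite subr_ge0. Qed.

Lemma step2_le n F G h h' : valid n h -> valid n h' ->
  (forall g g', valid n.+1 g -> valid n.+1 g' -> F g g' <= G g g') ->
  step2 p n F h h' <= step2 p n G h h'.
Proof.
move=> vh vh' FG; rewrite !step2E; apply: ler_sum => i _.
have p01' : 0 <= p <= 1 by case/andP: p01 => p0 p1; rewrite !ltW.
by apply: ler_wpM2l; [rewrite !mulr_ge0 ?bern_ge0 ?invr_ge0|
  apply: FG; exact: valid_extend].
Qed.

Lemma esp_le n F G :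
  (forall h h', valid n h -> valid n h' -> F h h' <= G h h') ->
  esp p s n F <= esp p s n G.
Proof.
elim: n F G => [|n IH] F G FG /=.
  apply: ler_sum => b _; apply: ler_wpM2l; first exact: bern_ge0.
  apply: ler_sum => b' _; apply: ler_wpM2l; first exact: bern_ge0.
  by apply: FG; [case: b | case: b'].
by apply: IH => h h' vh vh'; exact: step2_le.
Qed.

Lemma eq_esp n F G :
  (forall h h', valid n h -> valid n h' -> F h h' = G h h') ->
  esp p s n F = esp p s n G.
Proof. by move=> FG; apply/le_anti/andP; split; apply: esp_le => h h' *; rewrite FG. Qed.

(** As every entry is 1 or -1, each summand is affine in the remembered entry; averaging over the
    memory index replaces that entry by the mean [tot h / n.+1]. *)
Lemma step1E n G h : valid n h ->
  step1 p n G h = (1 + alpha * (tot h)%:~R / n.+1%:R) / 2 * G (rcons h 1)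
                + (1 - alpha * (tot h)%:~R / n.+1%:R) / 2 * G (rcons h (-1)).
Proof.
move=> vh; rewrite /step1 -(pair_bigA _ (fun (k : 'I_n.+1) c =>
  n.+1%:R^-1 * bern p c * G (extend h (k, c)))) /=.
have -> : (tot h)%:~R = \sum_(k < n.+1) (nth 0 h k)%:~R :> R.
  have /andP[/eqP sh _] := vh.
  by rewrite /tot (big_nth 0) sh big_mkord rmorph_sum.
have n0 : n.+1%:R != 0 :> R by rewrite pnatr_eq0.
transitivity (\sum_(k < n.+1) (n.+1%:R^-1 * (G (rcons h 1) + G (rcons h (-1))) / 2
   + alpha / n.+1%:R * (G (rcons h 1) - G (rcons h (-1))) / 2 * (nth 0 h k)%:~R)).
  apply: eq_bigr => k _; rewrite big_bool /= /extend /sgn /= /bern /alpha.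
  by case/orP: (valid_nth k vh) => /eqP ->; rewrite ?mulr1 ?mul1r ?mulrN1 ?opprK; field.
rewrite big_split /= sumr_const card_ord -mulr_sumr -mulr_natr.
by field.
Qed.

(** With [u] and [v] the conditional means of the two next steps, [a] is (1 + u)(1 - v)/4 and [b] is
    (1 - u)(1 + v)/4. They are chosen before [F], which needs to be a function of the difference
    only on extensions of the given histories, so it may carry an indicator of the past. *)
Lemma drift n h h' : valid n h -> valid n h' ->
  exists a b, [/\ minprob <= a, minprob <= b, a + b <= 1,
     a - b = alpha * dif h h' / (2 * n.+1%:R) &
     forall F (G : R -> R),
       (forall x x', pm1 x -> pm1 x' ->
          F (rcons h x) (rcons h' x') = G (dif (rcons h x) (rcons h' x'))) ->
       step2 p n F h h' = a * G (dif h h' + 2) + b * G (dif h h' - 2)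
          + (1 - a - b) * G (dif h h')].
Proof.
move=> vh vh'.
have bnd g : valid n g -> `|alpha * (tot g)%:~R / n.+1%:R| <= `|alpha|.
  move=> /andP[/eqP sg /tot_bound]; rewrite sg => tg.
  rewrite -mulrA normrM -[leRHS]mulr1 ler_wpM2l // normrM normfV.
  by rewrite [`|n.+1%:R|]ger0_norm // ler_pdivrMr // mul1r -intr_norm
    -[n.+1%:R]/(n.+1%:Z%:~R) ler_int.
have al1 := alpha_lt1.
have := bnd _ vh; have := bnd _ vh'.
set u := alpha * (tot h)%:~R / n.+1%:R; set v := alpha * (tot h')%:~R / n.+1%:R.
rewrite !ler_norml => /andP[v1 v2] /andP[u1 u2].
set e := `|alpha| in al1 u1 u2 v1 v2.
exists ((1 + u) * (1 - v) / 4), ((1 - u) * (1 + v) / 4).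
have ge w z : - e <= w -> w <= e -> - e <= z -> z <= e -> (1 - e) ^+ 2 <= (1 + w) * (1 + z).
  by move=> *; rewrite expr2; apply: ler_pM; lra.
split.
- by rewrite /minprob ler_pM2r ?invr_gt0 // ge; lra.
- by rewrite /minprob ler_pM2r ?invr_gt0 // ge; lra.
- have : 0 <= (1 + u) * (1 + v) + (1 - u) * (1 - v).
    by rewrite addr_ge0 // mulr_ge0; lra.
  lra.
- rewrite /u /v /dif intrB; have : n.+1%:R != 0 :> R by rewrite pnatr_eq0.
  by move: (n.+1%:R) => N N0; field.
move=> F G FG.
have Fx x x' : pm1 x -> pm1 x' ->
    F (rcons h x) (rcons h' x') = G (dif h h' + (x - x')%:~R).
  move=> px px'; rewrite FG // /dif !tot_rcons -intrD.
  by congr (G _%:~R); ring.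
rewrite /step2 step1E // !step1E // -/u -/v !Fx // subrr addr0.
by rewrite (_ : 1 - -1 = 2) // (_ : -1 - 1 = - 2) // mulrNz; field.
Qed.
End Drift.

(** * Recurrence *)

Lemma harmonic_unbounded (R : realType) m (B : R) :
  exists n, B < \sum_(m <= k < m + n) k.+1%:R^-1.
Proof.
apply: contrapT => /forallNP H.
have {}H n : \sum_(m <= k < m + n) k.+1%:R^-1 <= B.
  by rewrite leNgt; apply/negP/H.
apply: (@dvg_harmonic R); apply: nondecreasing_is_cvgn.
  by apply: nondecreasing_series => k _ _; rewrite /= invr_ge0.
exists (series (@harmonic R) m + B) => _ [n _ <-].
have ndh : nondecreasing_seq (series (@harmonic R)).
  by apply: nondecreasing_series => k _ _; rewrite /= invr_ge0.
apply: (@le_trans _ _ (series (@harmonic R) (m + n)%N)); first by apply: ndh; lia.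
rewrite /series /= (@big_cat_nat _ _ _ m 0 (m + n)) ?leq_addr //=.
by rewrite lerD2l.
Qed.

Section Survive.
Variables (R : realType) (p s : R).
Hypotheses (p01 : 0 < p < 1) (s01 : 0 <= s <= 1).

Local Notation alpha := (alpha p).
Local Notation mp := (minprob p).

(** The expectation is not normalised by the survival probability: the difference is killed at its
    first meeting from index [m] on. *)
Definition survive m n (g : R -> R) : R :=
  esp p s n (fun h h' => (nomeet m n h h')%:R * g (dif R h h')).

(** These are the properties of the step probabilities that [drift] supplies; the one-step estimates
    are proved for every such pair. *)
Definition admissible n (D a b : R) :=
  [/\ mp <= a, mp <= b, a + b <= 1 & a - b = alpha * D / (2 * n.+1%:R)].

Lemma survive_le m n g g' : (forall D, g D <= g' D) ->
  survive m n g <= survive m n g'.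
Proof. by move=> gg; apply: esp_le => // h h' _ _; apply: ler_wpM2l. Qed.

Lemma survive_lin m n c g g' :
  survive m n (fun D => c * g D + g' D) = c * survive m n g + survive m n g'.
Proof. by rewrite -esp_lin; apply: eq_esp => // h h' _ _; ring. Qed.

Lemma survive0 m n : survive m n (fun _ => 0) = 0.
Proof. by rewrite -[RHS](esp0 p s n); apply: eq_esp => // h h' _ _; rewrite mulr0. Qed.

Lemma survive_scale m n c g :
  survive m n (fun D => c * g D) = c * survive m n g.
Proof.
by rewrite -[RHS]addr0 -(survive0 m n) -survive_lin; apply: eq_esp => // h h' _ _; rewrite addr0.
Qed.

Lemma survive_ge0 m n g : (forall D, 0 <= g D) -> 0 <= survive m n g.
Proof. by move=> g0; rewrite -(survive0 m n); exact: survive_le. Qed.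

Lemma nomeet_last m n h h' : (m <= n)%N -> valid n h -> valid n h' ->
  nomeet m n h h' -> 2 <= `|dif R h h'|.
Proof.
move=> mn vh vh' /allP /(_ n); rewrite mem_iota mn (subnKC (leqW mn)) ltnSn.
have /andP[/eqP sh _] := vh; have /andP[/eqP sh' _] := vh'.
rewrite !take_oversize ?sh ?sh' // => /(_ isT).
by rewrite -(dif_eq0 R); case: (dif_dichotomy R vh vh') => // ->; rewrite eqxx.
Qed.

(** No meeting up to [n.+1] is no meeting up to [n], which is fixed by the past, together with a
    nonzero new difference. This leaves a pointwise inequality, needed only at [|D| >= 2] by
    parity. *)
Lemma survive_step m n g g' : (m <= n)%N ->
  (forall D a b, 2 <= `|D| -> admissible n D a b ->
     a * ((D + 2 != 0)%:R * g' (D + 2)) + b * ((D - 2 != 0)%:R * g' (D - 2))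
     + (1 - a - b) * ((D != 0)%:R * g' D) <= g D) ->
  survive m n.+1 g' <= survive m n g.
Proof.
move=> mn H; rewrite /survive /=; apply: esp_le => // h h' vh vh'.
have [a [b [a1 b1 ab1 ab st]]] := drift p01 vh vh'.
rewrite (st _ (fun D => (nomeet m n h h')%:R * ((D != 0)%:R * g' D))); last first.
  move=> x x' px px'.
  by rewrite nomeetS ?leqW // -(dif_eq0 R) -mulnb natrM -mulrA.
case: (boolP (nomeet m n h h')) => [nm|_]; last by rewrite !mul0r !mulr0 !addr0.
by rewrite !mul1r; apply: H; [exact: nomeet_last nm|split].
Qed.

(** Changing the sign of [D] exchanges [a] and [b], so positive differences suffice; there [x - 2]
    is still nonnegative, and [f' 0 = 0] makes the killing automatic. *)
Lemma survive_step_abs m n f f' : (m <= n)%N -> f' 0 = 0 ->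
  (forall x a b, 2 <= x -> admissible n x a b ->
     a * f' (x + 2) + b * f' (x - 2) + (1 - a - b) * f' x <= f x) ->
  survive m n.+1 (fun D => f' `|D|) <= survive m n (fun D => f `|D|).
Proof.
move=> mn f0 H; apply: survive_step => // D a b D2 adm.
have E d : (d != 0)%:R * f' `|d| = f' `|d|.
  by have [->|_] := eqVneq d 0; rewrite ?normr0 ?f0 ?mulr0 ?mul1r.
rewrite !E; have [D0|D0] := leP 0 D.
  rewrite (ger0_norm D0) in D2 *.
  by rewrite !ger0_norm ?H //; lra.
rewrite (ltr0_norm D0) in D2 *.
case: adm => a1 b1 ab1 ab.
have := H (- D) b a D2; rewrite !ler0_norm; [|lra..].
rewrite !opprD opprK => H'; apply: le_trans (H' _).
  by rewrite le_eqVlt; apply/orP; left; apply/eqP; ring.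
by split => //; [lra|rewrite mulrN mulNr -ab; ring].
Qed.

Definition surv m n := survive m n (fun _ => 1).

Lemma survE m n : surv m n = esp p s n (fun h h' => (nomeet m n h h')%:R).
Proof. by apply: eq_esp => // h h' _ _; rewrite mulr1. Qed.

Definition nrm n : R := \prod_(k < n) (1 + (2 * k.+1%:R)^-1).

Lemma nrmS n : nrm n.+1 = nrm n * (1 + (2 * n.+1%:R)^-1).
Proof. by rewrite /nrm big_ord_recr. Qed.

Lemma nrm_ge1 n : 1 <= nrm n.
Proof.
elim: n => [|n IH]; first by rewrite /nrm big_ord0.
rewrite nrmS -[leLHS]mul1r; apply: ler_pM => //.
by rewrite lerDl invr_ge0 mulr_ge0.
Qed.

(** The induction closes because (2N - 1)(1 + 1/(2N))^2 = (2N + 1)(1 - 1/(4N^2)). *)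
Lemma nrm_sqr n : nrm n ^+ 2 <= 2 * n%:R + 1.
Proof.
elim: n => [|n IH]; first by rewrite /nrm big_ord0 mulr0 add0r expr1n.
have N1 : 1 <= n.+1%:R :> R by rewrite ler1n.
have NE : n%:R = n.+1%:R - 1 :> R by rewrite -natr1 addrK.
rewrite nrmS exprMn; rewrite NE in IH; move: (n.+1%:R) N1 IH => N N1 IH.
apply: (@le_trans _ _ ((2 * (N - 1) + 1) * (1 + (2 * N)^-1) ^+ 2)).
  by rewrite ler_wpM2r ?sqr_ge0.
rewrite -subr_ge0 (_ : _ - _ = (2 * N + 1) / (4 * N ^+ 2)); last by field; lra.
by rewrite divr_ge0 ?mulr_ge0 ?sqr_ge0 //; lra.
Qed.

Section Recurrent.
Hypothesis al : alpha <= 2^-1.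

Lemma survive_abs_nonincr m n : (m <= n)%N ->
  survive m n.+1 (fun D => `|D| / nrm n.+1) <= survive m n (fun D => `|D| / nrm n).
Proof.
move=> mn; apply: (@survive_step_abs _ _ (fun x => x / _) (fun x => x / _)) => //.
  by rewrite mul0r.
move=> x a b x2 [a1 b1 ab1 ab].
have := nrm_ge1 n; have := nrmS n; have : 0 < n.+1%:R :> R by rewrite ltr0n.
move: (nrm n) (nrm n.+1) (n.+1%:R : R) ab => B B' N ab N0 BB B1.
by apply: (mean_step al N0 _ _ BB ab); lra.
Qed.

Lemma survive_phi_drop m n : (m <= n)%N ->
  survive m n.+1 (fun D => phi (`|D| / nrm n.+1)) <=
  survive m n (fun D => phi (`|D| / nrm n)) -
   4 * mp / (2 * n.+1%:R + 1) * survive m n (fun D => ((3 + `|D| / nrm n) ^+ 3)^-1).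
Proof.
move=> mn; rewrite addrC -mulNr -survive_lin.
apply: (@survive_step_abs _ _ (fun x => _ * ((3 + x / _) ^+ 3)^-1 + phi (x / _))
  (fun x => phi (x / _))) => //.
  by rewrite mul0r /phi addr0 invr1 subrr.
move=> x a b x2 [a1 b1 ab1 ab].
have := nrm_sqr n.+1; have := nrm_ge1 n; have := nrmS n; have : 0 < n.+1%:R :> R by rewrite ltr0n.
have := minprob_gt0 p01.
move: (nrm n) (nrm n.+1) (n.+1%:R : R) ab => B B' N ab mp0 N0 BB B1 B2.
rewrite mulNr [leRHS]addrC.
exact: (recurrent_step al N0 x2 B1 BB B2 (ltW mp0)).
Qed.

Lemma surv_small m e : 0 < e -> exists2 n, (m <= n)%N & surv m n <= e.
Proof.
move=> e0; apply: contrapT => H.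
have {}H n : (m <= n)%N -> e < surv m n.
  by move=> mn; rewrite ltNge; apply/negP => ?; apply: H; exists n.
pose Y (n : nat) (D : R) : R := `|D| / nrm n.
have Y0 n D : 0 <= Y n D.
  by rewrite divr_ge0 // (le_trans _ (nrm_ge1 n)).
have A0 := @survive_ge0 m m _ (Y0 m); set A := survive _ _ _ in A0.
have YA n : (m <= n)%N -> survive m n (Y n) <= A.
  move=> /subnKC <-; elim: (n - m)%N => [|k IH]; first by rewrite addn0.
  by rewrite addnS; apply: le_trans IH; apply: survive_abs_nonincr; rewrite leq_addr.
(* Chosen so that [A / K <= e / 2]; the added 1 keeps [K] positive when [A] is 0. *)
pose K := 2 * A / e + 1.
have K0 : 0 < K by rewrite ltr_wpDl // divr_ge0 ?mulr_ge0 // ltW.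
pose q := ((3 + K) ^+ 3)^-1.
have q0 : 0 < q by rewrite invr_gt0 exprn_gt0 // addr_gt0.
(* Markov's inequality in linear form: [(3 + y) ^- 3] is at least [q * (1 - y / K)], by monotonicity
   for [y <= K] and because the bound is negative beyond. Integrating leaves [q * (e - e / 2)]. *)
have lowY n : (m <= n)%N -> q * (e / 2) <= survive m n (fun D => ((3 + Y n D) ^+ 3)^-1).
  move=> mn.
  apply: (@le_trans _ _ (survive m n (fun D => - (q / K) * Y n D + q * 1))).
    rewrite survive_lin survive_scale -/(surv m n).
    have := H _ mn; have := YA _ mn; move: (survive m n _) (surv m n) => y u yA eu.
    have yK : y / K <= e / 2.
      rewrite ler_pdivrMr //; apply: le_trans yA _.
      rewrite (_ : e / 2 * K = A + e / 2) ?lerDl ?divr_ge0 ?ltW //.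
      by rewrite /K; field; rewrite lt0r_neq0.
    rewrite (_ : - (q / K) * y + q * u = q * (u - y / K)); last by field; rewrite lt0r_neq0.
    by rewrite ler_pM2l //; lra.
  apply: survive_le => D; have := Y0 n D; move: (Y n D) => y y0.
  rewrite mulr1; have [yK|yK] := leP y K.
    apply: (@le_trans _ _ q).
      by rewrite gerDr mulNr oppr_le0 mulr_ge0 // divr_ge0 ?ltW.
    rewrite lef_pV2 ?posrE; [|by apply: exprn_gt0; lra..].
    by rewrite ler_pXn2r ?nnegrE ?lerD2l //; lra.
  apply: (@le_trans _ _ 0); last by rewrite invr_ge0 exprn_ge0 // addr_ge0.
  rewrite addrC mulNr subr_le0 -mulrA; apply: ler_peMr; first exact: ltW.
  by rewrite mulrC ler_pdivlMr // mul1r ltW.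
(* The 3 comes from [2 * N + 1 <= 3 * N], which turns each loss into a multiple of [1 / N]. *)
pose w := 4 * mp * (q * (e / 2)) / 3.
have w0 : 0 < w.
  have mp0 := minprob_gt0 p01.
  apply: divr_gt0 => //; apply: mulr_gt0; first exact: mulr_gt0.
  by apply: mulr_gt0 => //; exact: divr_gt0.
have drop k : survive m (m + k)%N (fun D => phi (Y (m + k)%N D)) <=
   survive m m (fun D => phi (Y m D)) - w * \sum_(m <= j < m + k) j.+1%:R^-1.
  elim: k => [|k IH]; first by rewrite addn0 big_geq // mulr0 subr0.
  have mk : (m <= m + k)%N by rewrite leq_addr.
  rewrite addnS big_nat_recr //=.
  apply: le_trans (survive_phi_drop mk) _; rewrite -/(Y (m + k)%N).
  rewrite mulrDr opprD addrA; apply: lerB; first exact: IH.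
  have := lowY _ mk; rewrite -/(Y (m + k)%N); move: (survive m (m + k) _) => v qv.
  have mp0 := minprob_gt0 p01; have qe : 0 < q * (e / 2) by rewrite !mulr_gt0.
  have N1 : 1 <= (m + k).+1%:R :> R by rewrite ler1n.
  move: ((m + k).+1%:R : R) N1 => N N1.
  apply: (@le_trans _ _ (4 * mp / (2 * N + 1) * (q * (e / 2)))).
    rewrite (_ : w / N = 4 * mp * (q * (e / 2)) / (3 * N)); last first.
      by rewrite /w; field; rewrite !lt0r_neq0 //; lra.
    rewrite [leRHS]mulrAC ler_pM2l; last by apply: mulr_gt0 => //; exact: mulr_gt0.
    by rewrite lef_pV2 ?posrE; lra.
  apply: ler_wpM2l => //; apply: divr_ge0; last by lra.
  by apply: mulr_ge0 => //; exact: ltW.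
(* The accumulated losses exceed the initial value, although the expectation of [phi] stays
   nonnegative. *)
have [k] := harmonic_unbounded m (survive m m (fun D => phi (Y m D)) / w).
rewrite ltr_pdivrMr // mulrC => hk.
have := drop k.
have : 0 <= survive m (m + k)%N (fun D => phi (Y (m + k)%N D)).
  apply: survive_ge0 => D; have := Y0 (m + k)%N D; rewrite /phi.
  move: (Y _ _) => y y0; rewrite subr_ge0 invf_le1; lra.
lra.
Qed.
End Recurrent.
End Survive.

(** * Transience *)

Section Transient.
Variables (R : realType) (p s : R).
Hypotheses (p01 : 0 < p < 1) (s01 : 0 <= s <= 1).

Local Notation alpha := (alpha p).
Local Notation mp := (minprob p).
Hypothesis al : 2^-1 < alpha.

Lemma esp1 n : esp p s n (fun _ _ => 1) = 1.
Proof.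
elim: n => [|n IH] /=; first by rewrite !big_bool /=; ring.
rewrite -[RHS]IH; apply: eq_esp => // h h' vh vh'.
have [a [b [_ _ _ _ st]]] := drift p01 vh vh'.
by rewrite (st _ (fun _ => 1)) //; ring.
Qed.

(** The least [A] with [26 <= A * (2 * alpha - 1)], as [transient_step] requires. *)
Definition slack : R := 26 / (2 * alpha - 1).
(** The largest [eps] allowed by both [4 * eps <= 2 * alpha - 1] and [eps * A <= 4 * mp]. *)
Definition gain : R := Num.min ((2 * alpha - 1) / 4) (4 * mp / slack).

Local Notation A := slack.
Local Notation eps := gain.

Lemma slack_gt0 : 0 < A.
Proof. by rewrite divr_gt0 //; have := al; lra. Qed.

Lemma gain_gt0 : 0 < eps.
Proof.
have mp0 := minprob_gt0 p01; have A0 := slack_gt0.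
rewrite /gain lt_min; apply/andP; split; first by rewrite divr_gt0 //; have := al; lra.
by rewrite divr_gt0 // mulr_gt0.
Qed.

(** With N = n + 1, the shift to [k.+2] makes (N + 1) w_{n+1} equal to N w_n (1 + (1 + eps)/N), the
    factor in [transient_step]. *)
Definition wgt n : R := \prod_(k < n) (1 + eps / k.+2%:R).

Lemma wgtS n : wgt n.+1 = wgt n * (1 + eps / n.+2%:R).
Proof. by rewrite /wgt big_ord_recr. Qed.

Lemma wgt_ge1 n : 1 <= wgt n.
Proof.
elim: n => [|n IH]; first by rewrite /wgt big_ord0.
rewrite wgtS -[leLHS]mul1r; apply: ler_pM => //.
by rewrite lerDl divr_ge0 // ltW // gain_gt0.
Qed.

Lemma wgt_nondecr n : wgt n <= wgt n.+1.
Proof.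
rewrite wgtS ler_peMr ?(le_trans _ (wgt_ge1 n)) //.
by rewrite lerDl divr_ge0 // ltW // gain_gt0.
Qed.

(** Since [wgt] is at least 1, each new factor adds at least [eps] times a harmonic term. *)
Lemma wgt_ge_harmonic k : eps * \sum_(1 <= j < 1 + k) j.+1%:R^-1 <= wgt k.
Proof.
elim: k => [|k IH].
  by rewrite big_geq // mulr0 (le_trans _ (wgt_ge1 0)).
rewrite addnS big_nat_recr //= mulrDr wgtS mulrDr mulr1; apply: lerD => //.
rewrite -[leLHS]mul1r; apply: ler_wpM2r; last exact: wgt_ge1.
by rewrite divr_ge0 // ltW // gain_gt0.
Qed.

Lemma wgt_unbounded m B : exists2 n, (m <= n)%N & B < wgt n.
Proof.
have [k hk] := harmonic_unbounded 1 (B / eps).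
exists (maxn m k); first exact: leq_maxl.
apply: (@lt_le_trans _ _ (wgt k)).
  by apply: lt_le_trans (wgt_ge_harmonic k); rewrite mulrC -ltr_pdivrMr ?gain_gt0.
have nd : {homo wgt : i j / (i <= j)%N >-> i <= j}.
  by apply: homo_leq; [exact: lexx|exact: le_trans|exact: wgt_nondecr].
by apply: nd; exact: leq_maxr.
Qed.

Definition psi n (D : R) : R := n.+1%:R * wgt n / (A * n.+1%:R + D ^+ 2).

Lemma psi_ge0 n D : 0 <= psi n D.
Proof.
have w0 : 0 <= wgt n by rewrite (le_trans _ (wgt_ge1 n)).
apply: divr_ge0; first exact: mulr_ge0.
by apply: addr_ge0; [apply: mulr_ge0 => //; rewrite ltW // slack_gt0|exact: sqr_ge0].
Qed.

Lemma psi0 n : psi n 0 = wgt n / A.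
Proof.
rewrite /psi expr0n addr0; have A0 := slack_gt0; have : n.+1%:R != 0 :> R by rewrite pnatr_eq0.
by move: (n.+1%:R : R) => N N0; field; rewrite N0 lt0r_neq0.
Qed.

Lemma psi_supermartingale : exists n0, forall n D a b, (n0 <= n)%N ->
  admissible p n D a b ->
  a * psi n.+1 (D + 2) + b * psi n.+1 (D - 2) + (1 - a - b) * psi n.+1 D <= psi n D.
Proof.
have A0 := slack_gt0; have e0 := gain_gt0; have mp0 := minprob_gt0 p01.
(* The three lower bounds on N imposed by [transient_step]; being nonnegative, they are all
   dominated by their sum. *)
pose b1 := (2 * A + 9) * (1 + eps).
pose b2 := (2 * A + 9) * eps / (4 * mp).
pose b3 := (A + 4) ^+ 2 / A.
have b10 : 0 <= b1 by apply: mulr_ge0; lra.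
have b20 : 0 <= b2 by apply: divr_ge0; [apply: mulr_ge0|]; lra.
have b30 : 0 <= b3 by apply: divr_ge0; [exact: sqr_ge0|exact: ltW].
exists (Num.truncn (b1 + b2 + b3)) => n D a b nn [a1 b1' ab1 ab].
have : b1 + b2 + b3 <= n.+1%:R.
  by rewrite ltW // (lt_le_trans (truncnS_gt _)) // ler_nat.
have : 0 < n.+1%:R :> R by rewrite ltr0n.
have n2 : n.+2%:R = n.+1%:R + 1 :> R by rewrite -natr1.
rewrite /psi wgtS n2; move: ab.
have := wgt_ge1 n; move: (wgt n) => w w1.
move: (n.+1%:R : R) => N ab N0 bN.
have b1N : b1 <= N by clear -bN b20 b30; clearbody b1 b2 b3; lra.
have b2N : b2 <= N by clear -bN b10 b30; clearbody b1 b2 b3; lra.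
have b3N : b3 <= N by clear -bN b10 b20; clearbody b1 b2 b3; lra.
have h3 : (2 * A + 9) * eps <= 4 * mp * N.
  by rewrite [leRHS]mulrC -ler_pdivrMr; [exact: b2N|exact: mulr_gt0].
have h4 : (A + 4) ^+ 2 <= A * N by rewrite [leRHS]mulrC -ler_pdivrMr; [exact: b3N|].
have h2 : eps * A <= 4 * mp.
  by rewrite -ler_pdivlMr // /gain ge_min lexx orbT.
have hep : 4 * eps <= 2 * alpha - 1.
  by rewrite mulrC -ler_pdivlMr // /gain ge_min lexx.
have hA : 26 <= A * (2 * alpha - 1) by rewrite divfK //; have := al; lra.
have h1 : (2 * A + 9) * (1 + eps) <= N by [].
have := transient_step (ltW e0) A0 N0 mp0 hA hep h2 h1 h3 h4 a1 b1' ab1 ab.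
rewrite -(ler_pM2l (_ : 0 < N * w)); last by rewrite mulr_gt0 //; lra.
apply: le_trans; rewrite le_eqVlt; apply/orP; left; apply/eqP.
have -> : (N + 1) * (w * (1 + eps / (N + 1))) = N * w * (1 + (1 + eps) / N).
  by field; rewrite !lt0r_neq0 //; lra.
move: (_^-1) (_^-1) (_^-1) => i1 i2 i3.
ring.
Qed.

(** A maximal inequality without stopping times: [V] is the killed expectation of [psi - lam], and -
    lam * surv <= V n <= V m <= E m - lam gives surv >= 1 - E m / lam. Taking [m] with [wgt m] large
    makes the last quotient at most [e]. *)
Lemma surv_large e : 0 < e -> exists m, forall n, (m <= n)%N -> 1 - e <= surv p s m n.
Proof.
move=> e0; have [n0 sup] := psi_supermartingale.
have A0 := slack_gt0.
pose E n := esp p s n (fun h h' => psi n (dif R h h')).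
have En n : (n0 <= n)%N -> E n <= E n0.
  move=> /subnKC <-; elim: (n - n0)%N => [|k IH]; first by rewrite addn0.
  rewrite addnS; apply: le_trans IH; rewrite /E /=; apply: esp_le => // h h' vh vh'.
  have [a [b [a1 b1 ab1 ab st]]] := drift p01 vh vh'.
  by rewrite (st _ (psi (n0 + k).+1)) //; apply: sup => //; rewrite leq_addr.
have [m nm hm] := wgt_unbounded n0 (E n0 * A / e).
exists m => n mn.
pose lam := wgt m / A.
have w0 : 0 < wgt m by rewrite (lt_le_trans _ (wgt_ge1 m)).
have lam0 : 0 < lam by rewrite divr_gt0.
have nd : {homo wgt : i j / (i <= j)%N >-> i <= j}.
  by apply: homo_leq; [exact: lexx|exact: le_trans|exact: wgt_nondecr].
pose V k := survive p s m k (fun D => psi k D - lam).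
have Vm : V m <= E m - lam.
  rewrite -[lam]mulr1 -(esp1 m) addrC -mulNr -esp_lin; apply: esp_le => // h h' vh vh'.
  rewrite mulr1 nomeetnn // -(dif_eq0 R).
  by have [->|_] := eqVneq (dif R h h') 0; rewrite ?psi0 /lam ?mul0r ?mul1r; lra.
have Vn : V n <= V m.
  move: mn => /subnKC <-; elim: (n - m)%N => [|k IH]; first by rewrite addn0.
  rewrite addnS; apply: le_trans IH; apply: survive_step => //; first by rewrite leq_addr.
  move=> D a b _ adm.
  have adm' := adm; case: adm' => a1 b1 ab1 _; have mp0 := minprob_gt0 p01.
  (* Killing at a meeting only lowers the expectation, because there [psi] is [wgt / A], which is at
     least [lam] as [wgt] is nondecreasing. *)
  have le d : (d != 0)%:R * (psi (m + k).+1 d - lam) <= psi (m + k).+1 d - lam.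
    have [->|_] := eqVneq d 0; rewrite ?mul1r // mul0r psi0 subr_ge0.
    by rewrite ler_pM2r ?invr_gt0 // nd // -addnS leq_addr.
  have := sup (m + k)%N D a b (leq_trans nm (leq_addr _ _)) adm.
  have := ler_wpM2l (_ : 0 <= a) (le (D + 2)).
  have := ler_wpM2l (_ : 0 <= b) (le (D - 2)).
  have := ler_wpM2l (_ : 0 <= 1 - a - b) (le D).
  move=> /(_ ltac:(lra)) k3 /(_ ltac:(lra)) k2 /(_ ltac:(lra)) k1; lra.
have Vl : - lam * surv p s m n <= V n.
  rewrite -survive_scale //; apply: survive_le => // D.
  by rewrite mulr1; have := psi_ge0 n D; lra.
have El : E m <= e * lam.
  apply: le_trans (En _ nm) _; rewrite /lam mulrA ler_pdivlMr //.
  by rewrite [leRHS]mulrC -ler_pdivrMr // ltW.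
rewrite -(ler_pM2l lam0); lra.
Qed.
End Transient.

(** * From finite horizons to almost sure statements *)

Lemma size_hist (T : Type) (X : T -> bool) (U : forall m : nat, T -> 'I_m.+1)
  (C : nat -> T -> bool) n t : size (erw_hist X U C n t) = n.+1.
Proof. by elim: n => //= n IH; rewrite size_rcons IH. Qed.

Lemma take_hist (T : Type) (X : T -> bool) (U : forall m : nat, T -> 'I_m.+1)
    (C : nat -> T -> bool) k n t : (k <= n)%N ->
  take k.+1 (erw_hist X U C n t) = erw_hist X U C k t.
Proof.
elim: n => [|n IH]; first by rewrite leqn0 => /eqP ->.
rewrite leq_eqVlt => /predU1P[->|kn]; first by rewrite take_oversize // size_hist.
by rewrite /= -cats1 takel_cat ?size_hist // IH.
Qed.

Lemma pos_hist (T : Type) (X : T -> bool) (U : forall m : nat, T -> 'I_m.+1)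
    (C : nat -> T -> bool) k t :
  erw_pos X U C k.+1 t = tot (erw_hist X U C k t).
Proof.
(* [erw_pos] at time [k.+1] reads a history of k + 2 steps but sums only the first k + 1. *)
rewrite -(take_hist X U C t (leqnSn k)) /tot (big_nth 0) size_take size_hist ltnSn.
rewrite big_mkord /erw_pos; apply: eq_bigr => i _.
by rewrite nth_take.
Qed.

Theorem theorem1 (R : realType) (d : measure_display) (T : measurableType d)
  (P : probability T R) (p s : R)
  (X1 : bool -> T -> bool) (U : bool -> forall m : nat, T -> 'I_m.+1)
  (C : bool -> nat -> T -> bool) :
  0 < p < 1 -> 0 <= s <= 1 ->
  (forall a : atom, measurable (atom_event X1 U C a)) ->
  (forall w, P [set t | X1 w t = true] = s%:E) ->
  (forall w, P [set t | X1 w t = false] = (1 - s)%:E) ->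
  (forall w m (k : 'I_m.+1), P [set t | U w m t = k] = (m.+1%:R)^-1%:E) ->
  (forall w m, P [set t | C w m t = true] = p%:E) ->
  (forall w m, P [set t | C w m t = false] = (1 - p)%:E) ->
  mutually_independent P X1 U C ->
  let S := fun w n t => erw_pos (X1 w) (U w) (C w) n t in
  (p <= 3 / 4 ->
     P [set t | forall N : nat, exists n : nat,
                  (N <= n)%N /\ S false n t = S true n t] = 1%E) /\
  (3 / 4 < p ->
     P [set t | exists N : nat, forall n : nat,
                  (N <= n)%N -> S false n t <> S true n t] = 1%E).
Proof.
move=> p01 s01 mE PXt PXf PU PCt PCf ind S.
have PX w b : P [set t | X1 w t = b] = (bern s b)%:E by case: b.
have PC w m b : P [set t | C w m t = b] = (bern p b)%:E by case: b.
pose B m n := [set t | nomeet m n (erw_hist (X1 false) (U false) (C false) n t)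
                                  (erw_hist (X1 true) (U true) (C true) n t)].
have BE m n t : B m n t <-> forall k, (m <= k <= n)%N -> S false k.+1 t <> S true k.+1 t.
  rewrite /B /nomeet /=; split => [/allP nm k /andP[mk kn]|nm].
    have := nm k; rewrite mem_iota mk /= !take_hist // -!pos_hist.
    by move=> /(_ _)/eqP; apply; lia.
  apply/allP => k; rewrite mem_iota => /andP[mk kn].
  have kn' : (k <= n)%N by lia.
  by rewrite !take_hist // -!pos_hist; apply/eqP/nm; rewrite mk.
have [mB PB] : (forall m n, measurable (B m n)) /\
    (forall m n, P (B m n) = (surv p s m n)%:E).
  split=> m n; have [m1 m2] := prob_event mE PX PU PC ind n (nomeet m n); first exact: m1.
  by rewrite (survE p01 s01); exact: m2.
pose G m := \bigcap_k B m (m + k)%N.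
have GE m t : G m t <-> forall k, (m <= k)%N -> S false k.+1 t <> S true k.+1 t.
  split=> [Gt k mk|H n _]; last by apply/BE => k /andP[mk _]; exact: H.
  by have /BE := Gt (k - m)%N I; apply; rewrite subnKC // mk leqnn.
have mG m : measurable (G m) by exact: bigcap_measurable.
pose F := \bigcup_m G m.
have mF : measurable F by exact: bigcup_measurable.
have FE t : F t <-> exists N, forall n, (N <= n)%N -> S false n t <> S true n t.
  split=> [[m _ /GE Gt]|[N H]].
    (* [G m] concerns the times k + 1 with k >= m, so it excludes meetings from time [m.+1] on. *)
    by exists m.+1 => -[|n]// mn; exact: Gt.
  by exists N => //; apply/GE => k Nk; apply: H; exact: leqW.
split=> hp.
- have -> : [set t | forall N, exists n, (N <= n)%N /\ S false n t = S true n t] = ~` F.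
    apply/seteqP; split => t /=.
      by move=> H /FE[N HN]; have [n [Nn /(HN n Nn)]] := H N.
    move=> nF N; apply: contrapT => H; apply: nF; apply/FE; exists N => n Nn e.
    by apply: H; exists n.
  rewrite probability_setC // (_ : P F = 0%E) ?sube0 //.
  apply: measure_negligible => //; apply: negligible_bigcup => m.
  apply/negligibleP => //; apply/eqP; rewrite eq_le measure_ge0 andbT.
  (* [G m] lies in every [B m n], and some [B m n] has probability at most [e]. *)
  apply/lee_addgt0Pr => e e0; rewrite add0e.
  have al : alpha p <= 2^-1 by rewrite /alpha; lra.
  have [n mn sn] := surv_small p01 s01 al m e0.
  apply: (@le_trans _ _ (P (B m n))); last by rewrite PB lee_fin.
  apply: le_measure; rewrite ?inE //.
  by move=> t /GE Gt; apply/BE => k /andP[mk _]; exact: Gt.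
- rewrite (_ : [set t | _] = F); last by apply/seteqP; split=> t /FE.
  apply/eqP; rewrite eq_le probability_le1 //=.
  apply/lee_subgt0Pr => e e0.
  have al : 2^-1 < alpha p by rewrite /alpha; lra.
  have [m hm] := surv_large p01 s01 al e0.
  apply: (@le_trans _ _ (P (G m))); last first.
    by apply: le_measure; rewrite ?inE //; exact: bigcup_sup.
  (* Continuity from above carries the lower bound, uniform in the horizon, over to [G m]. *)
  have cvgG : P (B m (m + k)%N) @[k --> \oo] --> P (G m).
    apply: nonincreasing_cvg_mu => //; last 2 first.
    - exact: mG.
    - move=> i j ij; apply/subsetPset => t /BE H; apply/BE => k /andP[mk ki].
      by apply: H; rewrite mk (leq_trans ki) // leq_add2l.
    by rewrite (le_lt_trans (probability_le1 _ _)) // ltry.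
  rewrite -(cvg_lim _ cvgG) //; apply: lime_ge; first exact: cvgP cvgG.
  by apply: nearW => k; rewrite PB -EFinB lee_fin hm // leq_addr.
Qed.
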